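(* Let $X\subseteq\mathbb{R}^n$ be nonempty, closed and convex, let $F:\mathbb{R}^n\to\mathbb{R}^n$ be monotone and $L_1$-Lipschitz continuous, let $\Phi:\mathbb{R}^n\to\mathbb{R}^n$ be $\mu$-strongly monotone ($\mu>0$) and $L_2$-Lipschitz continuous, and suppose that $S=\{x\in\mathbb{R}^n: F(x)\in X,\ \langle y-F(x),x\rangle\ge0\ \forall y\in X\}$ is nonempty. Let $\{\lambda_k\}$ be a sequence of positive reals with $\lambda_k\downarrow0$. Then the sequence $\{x_{\lambda_k}\}$ is bounded, and every limit point of $\{x_{\lambda_k}\}$ belongs to $S$. Consequently, $\operatorname{dist}(x_{\lambda_k},S)\to0$.
   Context: For $\lambda>0$ put $F_\lambda=F+\lambda\Phi$; $x_\lambda$ denotes the unique point of $\mathbb{R}^n$ with $F_\lambda(x_\lambda)\in X$ and $\langle y-F_\lambda(x_\lambda),x_\lambda\rangle\ge0$ for all $y\in X$ (existence and uniqueness hold because $F_\lambda$ is strongly monotone and Lipschitz continuous). Monotone means $\langle F(x)-F(y),x-y\rangle\ge0$ for all $x,y$; $\mu$-strongly monotone means $\langle\Phi(x)-\Phi(y),x-y\rangle\ge\mu\|x-y\|^2$ for all $x,y$. $\|\cdot\|$ is the Euclidean norm and $\operatorname{dist}(x,S)=\inf_{s\in S}\|x-s\|$. *)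

(* Defs.v *)
From HB Require Import structures.
From mathcomp Require Import all_boot all_order all_algebra.
From mathcomp Require Import all_classical all_reals all_analysis.

Set Implicit Arguments.
Unset Strict Implicit.
Unset Printing Implicit Defensive.

Import Order.TTheory GRing.Theory Num.Theory.
Import numFieldNormedType.Exports.

Local Open Scope classical_set_scope.
Local Open Scope ring_scope.

(* R^n is 'rV[R]_n. The library norm `|x| on 'rV[R]_n is the sup norm, so the
   Euclidean structure is defined here; both norms induce the library topology
   of 'rV[R]_n, which is the one used for closedness and limit points. *)

Definition dotp (R : realType) (n : nat) (x y : 'rV[R]_n) : R :=
  \sum_(i < n) x 0 i * y 0 i.

Definition enorm (R : realType) (n : nat) (x : 'rV[R]_n) : R :=
  Num.sqrt (dotp x x).

(* The infimum is over a set of nonnegative reals; [inf set0 = 0], hence the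
   value is only meaningful for nonempty [A]. *)
Definition dist (R : realType) (n : nat) (x : 'rV[R]_n) (A : set 'rV[R]_n) : R :=
  inf [set enorm (x - s) | s in A].

Definition monotone_map (R : realType) (n : nat) (F : 'rV[R]_n -> 'rV[R]_n) : Prop :=
  forall x y, 0 <= dotp (F x - F y) (x - y).

Definition strongly_monotone (R : realType) (n : nat) (mu : R)
    (F : 'rV[R]_n -> 'rV[R]_n) : Prop :=
  forall x y, mu * enorm (x - y) ^+ 2 <= dotp (F x - F y) (x - y).

Definition elipschitz (R : realType) (n : nat) (L : R)
    (F : 'rV[R]_n -> 'rV[R]_n) : Prop :=
  forall x y, enorm (F x - F y) <= L * enorm (x - y).

Definition ivi_sol (R : realType) (n : nat) (X : set 'rV[R]_n)
    (F : 'rV[R]_n -> 'rV[R]_n) : set 'rV[R]_n :=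
  [set x | X (F x) /\ forall y, X y -> 0 <= dotp (y - F x) x].

Definition reg_map (R : realType) (n : nat) (F Phi : 'rV[R]_n -> 'rV[R]_n)
    (lam : R) : 'rV[R]_n -> 'rV[R]_n :=
  fun x => F x + lam *: Phi x.

(* [xget 0 A] is an element of [A] as soon as [A] is nonempty. For lam > 0, X
   nonempty closed convex, F monotone Lipschitz and Phi strongly monotone
   Lipschitz, the set [ivi_sol X (reg_map F Phi lam)] is a singleton, so that
   [reg_sol X F Phi lam] is its unique element x_lam; the default value 0 is
   never used. *)
Definition reg_sol (R : realType) (n : nat) (X : set 'rV[R]_n)
    (F Phi : 'rV[R]_n -> 'rV[R]_n) (lam : R) : 'rV[R]_n :=
  xget 0 (ivi_sol X (reg_map F Phi lam)).

(* Main.v *)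
Require Import Defs.
From HB Require Import structures.
From mathcomp Require Import all_boot all_order all_algebra.
From mathcomp Require Import all_classical all_reals all_analysis.
From mathcomp Require Import ring lra.
Import Order.TTheory GRing.Theory Num.Theory.
Import numFieldNormedType.Exports.
Local Open Scope classical_set_scope.
Local Open Scope ring_scope.

(** The point [x] solves the inverse variational inequality for [G] over [X]
    exactly when [G x] is the projection onto [X] of [G x - a x], for any fixed
    [a > 0].

    Each regularized problem has a solution because [x] is then a fixed point
    of [T x = (P u - u) / a] with [u = G x - a x] and [P] the projection onto
    [X]. The residual [P u - u] is nonexpansive in [u], and for [G] strongly
    monotone and Lipschitz the map [x |-> G x - a x] has a Lipschitz constant
    smaller than [a] once [a] is large, so [T] is a contraction
    ([ivi_sol_exists]). The projection and the fixed point of [T] both come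
    from minimizing a continuous function with bounded sublevel sets
    ([coercive_min]).

    The solutions are bounded by an energy estimate: testing the inequality at
    a solution [xs] of the limit problem with the regularized image of [x], and
    the one at [x] with the image of [xs], the monotone part drops out and
    leaves [dotp (Phi x) (x - xs) <= 0]; strong monotonicity of [Phi] turns it
    into [mu * enorm (x - xs) <= enorm (Phi xs)], a bound free of [lam]
    ([ivi_sol_reg_dist]).

    Limit points are solutions because the inequality is stable under
    simultaneous convergence of the parameter to 0 and of the point
    ([ivi_sol_reg_cvg]). Finally, a bounded sequence whose limit points all lie
    in a set approaches this set, by compactness
    ([bounded_cluster_dist_cvg0]). *)

(** * Euclidean structure on row vectors *)

Section euclidean.
Context {R : realType} {n : nat}.
Implicit Types (x y z : 'rV[R]_n) (a : R).

Lemma dotpC x y : dotp x y = dotp y x.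
Proof. by apply: eq_bigr => i _; rewrite mulrC. Qed.

Lemma dotpDl x y z : dotp (x + y) z = dotp x z + dotp y z.
Proof. by rewrite -big_split; apply: eq_bigr => i _; rewrite mxE mulrDl. Qed.

Lemma dotpZl a x y : dotp (a *: x) y = a * dotp x y.
Proof. by rewrite mulr_sumr; apply: eq_bigr => i _; rewrite mxE mulrA. Qed.

Lemma dotpNl x y : dotp (- x) y = - dotp x y.
Proof. by rewrite -scaleN1r dotpZl mulN1r. Qed.

Lemma dotpDr x y z : dotp x (y + z) = dotp x y + dotp x z.
Proof. by rewrite dotpC dotpDl !(dotpC x). Qed.

Lemma dotpZr a x y : dotp x (a *: y) = a * dotp x y.
Proof. by rewrite dotpC dotpZl (dotpC x). Qed.

Lemma dotpNr x y : dotp x (- y) = - dotp x y.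
Proof. by rewrite dotpC dotpNl (dotpC x). Qed.

Definition dotpE := (dotpDl, dotpDr, dotpNl, dotpNr, dotpZl, dotpZr).

Lemma dotp_ge0 x : 0 <= dotp x x.
Proof. by apply: sumr_ge0 => i _; rewrite -expr2 sqr_ge0. Qed.

Lemma enorm_ge0 x : 0 <= enorm x.
Proof. exact: sqrtr_ge0. Qed.

Lemma sqr_enorm x : enorm x ^+ 2 = dotp x x.
Proof. exact/sqr_sqrtr/dotp_ge0. Qed.

Lemma ler_coord_enorm x (i : 'I_n) : `|x 0 i| <= enorm x.
Proof.
rewrite -sqrtr_sqr; apply: ler_wsqrtr.
rewrite /dotp (bigD1 i) //= expr2 lerDl.
by apply: sumr_ge0 => j _; rewrite -expr2 sqr_ge0.
Qed.

(** The ambient norm is the sup norm; this comparison is what transfers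
    Euclidean estimates to the topology of row vectors. *)
Lemma ler_norm_enorm x : `|x| <= enorm x.
Proof.
rewrite [leLHS]mx_normrE; apply/bigmax_leP; split; first exact: enorm_ge0.
by move=> [i j] _ /=; rewrite (ord1 i) ler_coord_enorm.
Qed.

Lemma enorm_le0 x : enorm x <= 0 -> x = 0.
Proof.
by move=> x0; apply/eqP; rewrite -normr_le0 (le_trans (ler_norm_enorm x)).
Qed.

Lemma enorm0 : enorm (0 : 'rV[R]_n) = 0.
Proof. by rewrite /enorm -(scale0r 0) dotpZl mul0r sqrtr0. Qed.

Lemma enormZ a x : enorm (a *: x) = `|a| * enorm x.
Proof.
by rewrite /enorm dotpZl dotpZr mulrA -expr2 sqrtrM ?sqr_ge0// sqrtr_sqr.
Qed.

Lemma enormN x : enorm (- x) = enorm x.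
Proof. by rewrite -scaleN1r enormZ normrN1 mul1r. Qed.

Lemma enormB x y : enorm (x - y) = enorm (y - x).
Proof. by rewrite -enormN opprB. Qed.

Lemma cauchy_schwarz x y : dotp x y <= enorm x * enorm y.
Proof.
have [y0|y0] := leP (enorm y) 0.
  by rewrite (enorm_le0 _ y0) enorm0 -(scale0r 0) dotpZr mul0r mulr0.
apply: le_trans (ler_norm _) _.
rewrite -(@ler_pXn2r _ 2) ?nnegrE ?mulr_ge0 ?enorm_ge0// real_normK ?num_real//.
rewrite exprMn -(@ler_pM2r _ (enorm y ^+ 2)) ?exprn_gt0//.
(* nonnegativity of the squared norm of the component of x orthogonal to y,
   scaled by the squared norm of y *)
have := dotp_ge0 (dotp y y *: x - dotp x y *: y).
rewrite !dotpE (dotpC y x) !sqr_enorm; nra.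
Qed.

Lemma enormD x y : enorm (x + y) <= enorm x + enorm y.
Proof.
rewrite -(@ler_pXn2r _ 2) ?nnegrE ?addr_ge0 ?enorm_ge0// sqrrD !sqr_enorm !dotpE.
by rewrite (dotpC y x); have := cauchy_schwarz x y; lra.
Qed.

(** * Convergence, compactness and minimization *)

Section cvg.
Context {T : Type} {H : set_system T} {FH : Filter H}.
Implicit Types (f g : T -> 'rV[R]_n).

Lemma cvg_dotp f g x y : f @ H --> x -> g @ H --> y ->
  dotp (f t) (g t) @[t --> H] --> dotp x y.
Proof.
move=> fx gy; apply: cvg_big => [|i _]; first exact: add_continuous.
apply: cvgM.
  exact: (cvg_comp _ _ fx (@coord_continuous _ _ _ _ _ x)).
exact: (cvg_comp _ _ gy (@coord_continuous _ _ _ _ _ y)).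
Qed.

Lemma cvg_enorm f x : f @ H --> x -> enorm (f t) @[t --> H] --> enorm x.
Proof.
move=> fx; apply: (cvg_comp _ (@Num.sqrt R) (cvg_dotp _ _ _ _ fx fx)).
exact: sqrt_continuous.
Qed.

Lemma enorm_cvg f x : enorm (f t - x) @[t --> H] --> 0 -> f @ H --> x.
Proof.
move=> fx; apply/cvgrPdist_lt => e e0; near=> t.
rewrite (le_lt_trans (ler_norm_enorm _))// enormB.
by near: t; exact: (cvgr_lt _ fx).
Unshelve. all: by end_near. Qed.

End cvg.

Lemma elipschitz_continuous L (F : 'rV[R]_n -> 'rV[R]_n) :
  elipschitz L F -> continuous F.
Proof.
move=> FL x; apply: (@enorm_cvg _ (nbhs x)).
apply: (squeeze_cvgr (f := cst 0) (h := fun y => L * enorm (y - x))).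
- by near=> y; rewrite enorm_ge0 FL.
- exact: cvg_cst.
- rewrite -(mulr0 L) -enorm0 -(subrr x); apply: cvgM; first exact: cvg_cst.
  apply: (cvg_enorm (fun y => y - x)).
  by apply: cvgB; [exact: cvg_id|exact: cvg_cst].
Unshelve. all: by end_near. Qed.

Lemma enorm_continuous : continuous (@enorm R n).
Proof. by move=> x; apply: (@cvg_enorm _ (nbhs x) _ id). Qed.

Lemma sublevel_closed {f : 'rV[R]_n -> R} {M} :
  continuous f -> closed [set x | f x <= M].
Proof.
move=> fc; have := @preimage_closed _ _ f [set r | r <= M].
by apply; [move=> x _; exact: fc|exact: closed_le].
Qed.

Lemma enorm_ball_compact (M : R) : compact [set x : 'rV[R]_n | enorm x <= M].
Proof.
apply: bounded_closed_compact.
  exists M; split; first exact: num_real.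
  move=> b Mb x /= xM.
  by rewrite (le_trans (ler_norm_enorm x))// (le_trans xM)// ltW.
exact: sublevel_closed enorm_continuous.
Qed.

(** The sublevel set of [f] through [x0] is compact, and a minimum over it is a
    minimum over [C]. *)
Lemma coercive_min (C : set 'rV[R]_n) (f : 'rV[R]_n -> R) x0 M :
  closed C -> C x0 -> continuous f ->
  (forall x, C x -> f x <= f x0 -> enorm x <= M) ->
  exists2 x, C x & forall y, C y -> f x <= f y.
Proof.
move=> Ccl Cx0 fc fM.
pose K := C `&` [set x | f x <= f x0].
have Kcl : closed K by exact: closedI Ccl (sublevel_closed fc).
have Kc : compact K.
  apply: subclosed_compact Kcl (enorm_ball_compact M) _.
  by move=> x [Cx fx]; exact: fM.
have [x Kx xmin] := compact_EVT_min (ex_intro _ x0 (conj Cx0 (lexx _)) : K !=set0)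
  Kc (continuous_subspaceT fc).
move: Kx; rewrite inE => -[Cx fx]; exists x => // y Cy.
have [yx0|/ltW x0y] := leP (f y) (f x0); last exact: le_trans x0y.
by apply: xmin; rewrite inE.
Qed.

End euclidean.

(** * Existence of solutions *)

Section existence.
Context {R : realType} {n : nat}.
Implicit Types (x y u : 'rV[R]_n).

(** A point [p] of [X] nearest to [u] satisfies the obtuse angle inequality:
    were [dotp (u - p) (y - p)] positive, a small step from [p] towards [y]
    would stay in [X] and come closer to [u]. *)
Lemma exists_projection (X : set 'rV[R]_n) :
  X !=set0 -> closed X -> convex_set (M := 'rV[R]_n) X ->
  exists P : 'rV[R]_n -> 'rV[R]_n,
    forall u, X (P u) /\ forall y, X y -> dotp (u - P u) (y - P u) <= 0.
Proof.
move=> [x0 Xx0] Xcl Xcvx.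
suff /choice[P PP] : forall u, exists p, X p /\
    forall y, X y -> dotp (u - p) (y - p) <= 0 by exists P.
move=> u.
have [||p Xp pmin] := @coercive_min _ _ X (fun y => enorm (y - u)) x0
    (enorm (x0 - u) + enorm u) Xcl Xx0.
- move=> y; apply: (@cvg_enorm _ _ _ (nbhs y) _ (fun y => y - u)).
  by apply: cvgB; [exact: cvg_id|exact: cvg_cst].
- move=> y _ yx0; rewrite -{1}(subrK u y).
  by rewrite (le_trans (enormD _ _))// lerD2r.
exists p; split=> // y Xy; rewrite leNgt; apply/negP => d_gt0.
set d := dotp _ _ in d_gt0; pose e := dotp (y - p) (y - p).
have e_ge0 : 0 <= e := dotp_ge0 _.
have de_gt0 : 0 < d + e by rewrite ltr_wpDr.
(* at this parameter the quadratic t ^ 2 e - 2 t d is negative *)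
pose t := d / (d + e).
have tde : t * (d + e) = d by rewrite /t divfK// gt_eqF.
have t_gt0 : 0 < t by rewrite divr_gt0.
have t_le1 : t <= 1 by rewrite ler_pdivrMr// mul1r lerDl.
have Xq : X (t *: y + (1 - t) *: p).
  have := Xcvx y p (Itv01 (ltW t_gt0) t_le1) (mem_set Xy) (mem_set Xp).
  by rewrite inE.
have := pmin _ Xq.
rewrite -(@ler_pXn2r _ 2) ?nnegrE ?enorm_ge0// !sqr_enorm.
have -> : t *: y + (1 - t) *: p - u = (p - u) + t *: (y - p).
  by apply/rowP => i; rewrite !mxE; ring.
have -> : dotp (p - u + t *: (y - p)) (p - u + t *: (y - p)) =
    dotp (p - u) (p - u) - 2 * t * d + t ^+ 2 * e.
  rewrite /d /e !dotpE (dotpC y p) (dotpC u p) (dotpC u y); ring.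
nra.
Qed.

(** Minimizing [enorm (T x - x)] rather than iterating [T] avoids having to make
    the row vectors a complete space for the Euclidean norm: applying [T] to a
    minimizer shrinks the displacement by [c], so its minimum is 0. *)
Lemma contraction_fixpoint c (T : 'rV[R]_n -> 'rV[R]_n) :
  c < 1 -> elipschitz c T -> exists x, T x = x.
Proof.
move=> c1 Tc.
have c1_gt0 : 0 < 1 - c by rewrite subr_gt0.
have [||x _ xmin] := @coercive_min _ _ setT (fun x => enorm (T x - x)) 0
    ((enorm (T 0) + enorm (T 0)) / (1 - c)) (@closedT _) I.
- move=> x; apply: (@cvg_enorm _ _ _ (nbhs x) _ (fun x => T x - x)).
  by apply: cvgB; [exact: elipschitz_continuous Tc _|exact: cvg_id].
- move=> x _; rewrite subr0 ler_pdivlMr// => Tx.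
  have := enormD (T x - T 0) (T 0); rewrite subrK => Tx0.
  have := enormD (x - T x) (T x); rewrite subrK enormB => xTx.
  by have := Tc x 0; rewrite subr0; lra.
exists x; apply/eqP; rewrite -subr_eq0; apply/eqP/enorm_le0.
by have := Tc (T x) x; have := xmin (T x) I; have := enorm_ge0 (T x - x); nra.
Qed.

(** For [u = G x - a x], the obtuse angle inequality at [P u = G x] reads
    [dotp (- a x) (y - G x) <= 0], which is the inequality wanted. Such an [x]
    is a fixed point of [T x = (P u - u) / a], a contraction for large [a]. *)
Lemma ivi_sol_exists (X : set 'rV[R]_n) (G : 'rV[R]_n -> 'rV[R]_n) L m :
  X !=set0 -> closed X -> convex_set (M := 'rV[R]_n) X ->
  0 < m -> strongly_monotone m G -> elipschitz L G -> ivi_sol X G !=set0.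
Proof.
move=> X0 Xcl Xcvx m_gt0 Gm GL.
have [P PP] := exists_projection X X0 Xcl Xcvx.
(* any a with L ^ 2 < 2 a m makes the factor k below smaller than 1 *)
pose a := L ^+ 2 / m + m.
have a_gt0 : 0 < a by rewrite ltr_wpDl// divr_ge0 ?sqr_ge0// ltW.
have am : a * m = L ^+ 2 + m ^+ 2 by rewrite mulrDl divfK ?gt_eqF// expr2.
pose r u := P u - u.
(* the obtuse angle inequalities at [u] and [v], each tested with the other
   projection, add up to [dotp (P u - P v) (r u - r v) <= 0] *)
have r_le u v : enorm (r u - r v) <= enorm (u - v).
  rewrite -(@ler_pXn2r _ 2) ?nnegrE ?enorm_ge0// !sqr_enorm.
  have [XPu Pu] := PP u; have [XPv Pv] := PP v.
  have := Pu _ XPv; have := Pv _ XPu.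
  have := dotp_ge0 (P u - P v).
  rewrite /r !dotpE (dotpC (P v) (P u)) (dotpC v u) (dotpC (P u) u)
    (dotpC (P v) u) (dotpC (P u) v) (dotpC (P v) v).
  lra.
pose T x := a^-1 *: r (G x - a *: x).
pose k := (L ^+ 2 - 2 * a * m + a ^+ 2) / a ^+ 2.
have k_lt1 : k < 1.
  by rewrite ltr_pdivrMr ?exprn_gt0//; have := exprn_gt0 2 m_gt0; nra.
(* a negative [k], for which [Num.sqrt k = 0], needs no separate case: the
   squared bound then holds only with both sides equal to 0 *)
have TL : elipschitz (Num.sqrt k) T.
  move=> x y.
  rewrite /T -scalerBr enormZ gtr0_norm ?invr_gt0//.
  rewrite ler_pdivrMl//; apply: le_trans (r_le _ _) _.
  have -> : a * (Num.sqrt k * enorm (x - y)) =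
      Num.sqrt (a ^+ 2 * (dotp (x - y) (x - y) * k)).
    rewrite [RHS]sqrtrM ?sqr_ge0// sqrtr_sqr gtr0_norm//.
    rewrite [Num.sqrt (_ * k)]sqrtrM ?dotp_ge0//.
    by rewrite [Num.sqrt k * _]mulrC.
  apply: ler_wsqrtr.
  rewrite mulrCA [a ^+ 2 * k]mulrC divfK ?gt_eqF ?exprn_gt0//.
  have := Gm x y; rewrite sqr_enorm.
  have : dotp (G x - G y) (G x - G y) <= L ^+ 2 * dotp (x - y) (x - y).
    rewrite -!sqr_enorm -exprMn ler_pXn2r ?nnegrE ?enorm_ge0//.
    by rewrite (le_trans (enorm_ge0 (G x - G y))).
  have -> : G x - a *: x - (G y - a *: y) = (G x - G y) - a *: (x - y).
    by apply/rowP => i; rewrite !mxE; ring.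
  move: (G x - G y) (x - y) => g z; rewrite !dotpE (dotpC z g) => gL gm.
  have : 2 * a * (m * dotp z z) <= 2 * a * dotp g z.
    by rewrite ler_pM2l// mulr_gt0.
  lra.
have sk1 : Num.sqrt k < 1 by rewrite -sqrtr1 ltr_sqrt.
have [x Tx] := contraction_fixpoint _ _ sk1 TL.
have PG : P (G x - a *: x) = G x.
  have ru : r (G x - a *: x) = a *: x.
    by rewrite -{3}Tx scalerA divff ?gt_eqF// scale1r.
  by rewrite -[P _](subrK (G x - a *: x)) -/(r _) ru addrC subrK.
have [XP Pv] := PP (G x - a *: x); rewrite PG in XP Pv.
exists x; split=> // y Xy; have := Pv y Xy.
by rewrite addrAC subrr add0r dotpNl dotpZl oppr_le0 pmulr_rge0// dotpC.
Qed.

End existence.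

(** * Regularized problems *)

Section regularization.
Context {R : realType} {n : nat}.
Implicit Types (x y p : 'rV[R]_n) (X : set 'rV[R]_n).
Implicit Types (F Phi : 'rV[R]_n -> 'rV[R]_n).

Lemma reg_map_strongly_monotone F Phi mu lam : 0 <= lam ->
  monotone_map F -> strongly_monotone mu Phi ->
  strongly_monotone (lam * mu) (reg_map F Phi lam).
Proof.
move=> lam_ge0 F_mono Phi_mono x y.
have -> : reg_map F Phi lam x - reg_map F Phi lam y =
    (F x - F y) + lam *: (Phi x - Phi y).
  by apply/rowP => i; rewrite !mxE; ring.
rewrite dotpDl dotpZl -mulrA ler_wpDl ?F_mono//.
by rewrite ler_wpM2l ?Phi_mono.
Qed.

Lemma reg_map_lipschitz F Phi L1 L2 lam : 0 <= lam ->
  elipschitz L1 F -> elipschitz L2 Phi ->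
  elipschitz (L1 + lam * L2) (reg_map F Phi lam).
Proof.
move=> lam_ge0 F_lip Phi_lip x y.
have -> : reg_map F Phi lam x - reg_map F Phi lam y =
    (F x - F y) + lam *: (Phi x - Phi y).
  by apply/rowP => i; rewrite !mxE; ring.
rewrite (le_trans (enormD _ _))// mulrDl lerD ?F_lip// enormZ ger0_norm//.
by rewrite -mulrA ler_wpM2l ?Phi_lip.
Qed.

Lemma reg_solP X F Phi L1 L2 mu lam :
  X !=set0 -> closed X -> convex_set (M := 'rV[R]_n) X ->
  monotone_map F -> elipschitz L1 F ->
  0 < mu -> strongly_monotone mu Phi -> elipschitz L2 Phi -> 0 < lam ->
  ivi_sol X (reg_map F Phi lam) (reg_sol X F Phi lam).
Proof.
move=> X0 Xcl Xcvx F_mono F_lip mu_gt0 Phi_mono Phi_lip lam_gt0.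
apply: xgetPex; apply: ivi_sol_exists X0 Xcl Xcvx (mulr_gt0 lam_gt0 mu_gt0) _ _.
  exact: reg_map_strongly_monotone (ltW lam_gt0) F_mono Phi_mono.
exact: reg_map_lipschitz (ltW lam_gt0) F_lip Phi_lip.
Qed.

(** The two inequalities, each tested with the image given by the other
    solution, add up to [0 <= dotp (F xs - reg_map F Phi lam x) (x - xs)].
    Monotonicity of [F] and division by [lam] leave
    [dotp (Phi x) (x - xs) <= 0], so that the bound does not depend on [lam]. *)
Lemma ivi_sol_reg_dist X F Phi mu lam x xs :
  monotone_map F -> 0 < mu -> strongly_monotone mu Phi -> 0 < lam ->
  ivi_sol X F xs -> ivi_sol X (reg_map F Phi lam) x ->
  mu * enorm (x - xs) <= enorm (Phi xs).
Proof.
move=> F_mono mu_gt0 Phi_mono lam_gt0 [Xs sP] [Xx xP].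
have Phi_le0 : dotp (Phi x) (x - xs) <= 0.
  rewrite -(pmulr_rle0 _ lam_gt0).
  have := xP _ Xs; have := sP _ Xx; have := F_mono x xs.
  by rewrite /reg_map !dotpE; lra.
have := Phi_mono x xs; have := cauchy_schwarz (- Phi xs) (x - xs).
rewrite enormN dotpNl (dotpDl (Phi x)) dotpNl => CS mu_le.
have [N_le0|N_gt0] := leP (enorm (x - xs)) 0.
  by rewrite (le_trans _ (enorm_ge0 _))// pmulr_rle0.
by rewrite -(ler_pM2r N_gt0); lra.
Qed.

(** Both the membership and, for a fixed [y], the inequality are closed
    conditions on the pair of the point and its image. *)
Lemma ivi_sol_reg_cvg {T : Type} {H : set_system T} {FH : ProperFilter H}
    X F Phi (u : T -> 'rV[R]_n) (lam : T -> R) p :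
  closed X -> continuous F -> continuous Phi ->
  (forall t, ivi_sol X (reg_map F Phi (lam t)) (u t)) ->
  lam @ H --> 0 -> u @ H --> p -> ivi_sol X F p.
Proof.
move=> Xcl Fc Phic uP lam0 up.
have Fup : reg_map F Phi (lam t) (u t) @[t --> H] --> F p.
  rewrite -[F p]addr0 -(scale0r (Phi p)); apply: cvgD.
    exact: (cvg_comp _ _ up (Fc p)).
  by apply: cvgZ => //; exact: (cvg_comp _ _ up (Phic p)).
split.
  by apply: (closed_cvg X Xcl _ _ Fup); near=> t; have [] := uP t.
move=> y Xy.
apply: (closed_cvg [set r : R | 0 <= r] (@closed_ge _ _) _
  (dotp (y - F p) p) (cvg_dotp (fun t => y - reg_map F Phi (lam t) (u t)) u
    (y - F p) p _ up)).
  by near=> t; have [_] := uP t; apply.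
by apply: cvgB => //; exact: cvg_cst.
Unshelve. all: by end_near. Qed.

End regularization.

(** * Limit points of sequences *)

Lemma cluster_subseq {R : realType} {V : normedModType R} (u : nat -> V) p :
  cluster (u @ \oo) p ->
  exists2 k : nat -> nat, k @ \oo --> \oo & u (k j) @[j --> \oo] --> p.
Proof.
move=> up.
have /choice[k kP] : forall j, exists k, (j <= k)%N /\ `|p - u k| < j.+1%:R^-1.
  move=> j.
  have j_gt0 : (0 : R) < j.+1%:R^-1 by rewrite invr_gt0.
  have [|_ [[i ji <-]]] := up [set u i | i in [set i | (j <= i)%N]]
      (ball p j.+1%:R^-1) _ (nbhsx_ballx p _ j_gt0).
    by exists j => // i; exists i.
  by rewrite -ball_normE; exists i.
exists k.
  move=> A [N _ NA]; exists N => // j Nj; apply: NA => /=.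
  by rewrite (leq_trans Nj)//; have [] := kP j.
apply/cvgrPdist_lt => e e_gt0; near=> j.
have [_ /lt_trans] := kP j; apply.
by near: j; exact: (near_infty_natSinv_lt (PosNum e_gt0)).
Unshelve. all: by end_near. Qed.

Section distance.
Context {R : realType} {n : nat}.
Implicit Types (x s : 'rV[R]_n) (A : set 'rV[R]_n).

Lemma dist_ge0 x A : A !=set0 -> 0 <= dist x A.
Proof.
move=> [s As]; apply: lb_le_inf; first by exists (enorm (x - s)), s.
by move=> _ [y _ <-]; exact: enorm_ge0.
Qed.

Lemma dist_le x s A : A s -> dist x A <= enorm (x - s).
Proof.
move=> As; apply: ge_inf; last by exists s.
by exists 0 => _ [y _ <-]; exact: enorm_ge0.
Qed.

(** Otherwise the indices at which the distance is at least some [e > 0] occur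
    infinitely often; along them the bounded sequence has a limit point, which
    lies in [A], and terms near that point are closer than [e] to [A]. *)
Lemma bounded_cluster_dist_cvg0 (u : nat -> 'rV[R]_n) A M :
  A !=set0 -> (forall k, enorm (u k) <= M) -> cluster (u @ \oo) `<=` A ->
  dist (u k) A @[k --> \oo] --> 0.
Proof.
move=> A0 uM uA; apply/cvgrPdist_lt => e e_gt0.
under eq_near do rewrite sub0r normrN ger0_norm ?dist_ge0//.
apply: contrapT => far.
pose D := [set k | e <= dist (u k) A].
have WD : ProperFilter (within D \oo).
  split; last exact: within_filter.
  move=> /= D0; apply: far; near=> k; rewrite ltNge; apply/negP.
  by near: k; exact: D0.
have [p [_ pc]] : [set x | enorm x <= M] `&` cluster (u @ within D \oo) !=set0.
  by apply: enorm_ball_compact; exists 0%N => // k _ _; exact: uM.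
have Ap : A p by apply: uA; apply: cvg_cluster pc; exact: cvg_app (cvg_within _).
have e_p : \forall y \near p, enorm (y - p) < e.
  apply: (@cvgr_lt R _ (nbhs p) _ (fun y => enorm (y - p)) 0) => //.
  rewrite -[X in _ --> X](@enorm0 R n) -(subrr p).
  apply: (@cvg_enorm _ _ _ (nbhs p) _ (fun y => y - p)).
  by apply: cvgB; [exact: cvg_id|exact: cvg_cst].
have [|_ [[k Dk <-] /= kp]] := pc [set u k | k in D] _ _ e_p.
  by exists 0%N => // k _ Dk; exists k.
by move: Dk; rewrite /D /= leNgt (le_lt_trans (dist_le _ _ _ Ap)).
Unshelve. all: by end_near. Qed.

End distance.

Theorem lemma10 (R : realType) (n : nat) (X : set 'rV[R]_n)
    (F Phi : 'rV[R]_n -> 'rV[R]_n) (L1 L2 mu : R) (lam : nat -> R)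
    (X_nonempty : X !=set0) (X_closed : closed X)
    (X_convex : convex_set (M := 'rV[R]_n) X)
    (F_mono : monotone_map F) (F_lip : elipschitz L1 F)
    (mu_gt0 : 0 < mu) (Phi_mono : strongly_monotone mu Phi)
    (Phi_lip : elipschitz L2 Phi)
    (S_nonempty : ivi_sol X F !=set0)
    (lam_gt0 : forall k, 0 < lam k)
    (lam_decr : nonincreasing_seq lam)
    (lam_cvg0 : lam @ \oo --> (0 : R)) :
  [/\ exists M : R, forall k, enorm (reg_sol X F Phi (lam k)) <= M,
      forall p : 'rV[R]_n,
        cluster ((fun k => reg_sol X F Phi (lam k)) @ \oo) p -> ivi_sol X F p
    & (fun k => dist (reg_sol X F Phi (lam k)) (ivi_sol X F)) @ \oo --> (0 : R)].
Proof.
have solP k : ivi_sol X (reg_map F Phi (lam k)) (reg_sol X F Phi (lam k)).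
  exact: reg_solP X_nonempty X_closed X_convex F_mono F_lip mu_gt0 Phi_mono
    Phi_lip (lam_gt0 k).
have [xs Sxs] := S_nonempty.
pose M := enorm (Phi xs) / mu + enorm xs.
have solM k : enorm (reg_sol X F Phi (lam k)) <= M.
  rewrite -{1}(subrK xs (reg_sol _ _ _ _)) (le_trans (enormD _ _))// lerD2r.
  rewrite ler_pdivlMr// mulrC.
  exact: ivi_sol_reg_dist F_mono mu_gt0 Phi_mono (lam_gt0 k) Sxs (solP k).
have solS : cluster ((fun k => reg_sol X F Phi (lam k)) @ \oo) `<=` ivi_sol X F.
  move=> p /cluster_subseq[k koo kp].
  apply: (ivi_sol_reg_cvg X F Phi _ (lam \o k) p X_closed
    (elipschitz_continuous _ _ F_lip) (elipschitz_continuous _ _ Phi_lip) _ _ kp).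
    by move=> j; exact: solP.
  exact: (cvg_comp _ _ koo lam_cvg0).
split; [by exists M|exact: solS|].
exact: bounded_cluster_dist_cvg0 S_nonempty solM solS.
Qed.
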